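(* Let $a, c$ be nonnegative integers. Then there exists a unique nonnegative integer $b$ such that $\mathcal{G}_{\mathcal{E}}(a,b) = c$.
   Context: A position is an unordered pair $(a,b)$ of nonnegative integers (pile sizes). $\mathcal{E}$-Wythoff: a move either removes a positive number of tokens from one pile, or removes the same positive number of tokens from both piles, or removes $k$ tokens from the smaller pile (or from either pile if the piles are equal) and $l$ tokens from the other pile, for integers $k \geq 1$, $l\ge 0$ with $l < k$. $\mathcal{G}_{\mathcal{E}}$ is its Sprague-Grundy function: $\mathcal{G}_{\mathcal{E}}(p)=\mathrm{mex}\{\mathcal{G}_{\mathcal{E}}(q): q \text{ reachable from } p \text{ in one move}\}$, where $\mathrm{mex}(S)$ is the least nonnegative integer not in $S$ and $\mathrm{mex}\{\}=0$. *)

(* Defs.v *)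
From mathcomp Require Import all_boot.
From mathcomp Require Import zify.

Set Implicit Arguments.
Unset Strict Implicit.
Unset Printing Implicit Defensive.

(* An unordered pair of piles is represented by either of its two orderings:  *)
(* the rules treat both piles alike, and [grundyC] shows that the Grundy      *)
(* function descends to unordered pairs.                                      *)
Definition position := (nat * nat)%type.

Inductive move : position -> position -> Prop :=
| Move_fst a b k : 0 < k <= a -> move (a, b) (a - k, b)
| Move_snd a b k : 0 < k <= b -> move (a, b) (a, b - k)
| Move_both a b k : 0 < k <= minn a b -> move (a, b) (a - k, b - k)
| Move_smaller_fst a b k l :
    a <= b -> 0 < k <= a -> l < k -> move (a, b) (a - k, b - l)
| Move_smaller_snd a b k l :
    b <= a -> 0 < k <= b -> l < k -> move (a, b) (a - l, b - k).

Definition options (p : position) : seq position :=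
  let: (a, b) := p in
     [seq (a - k, b) | k <- iota 1 a]
  ++ [seq (a, b - k) | k <- iota 1 b]
  ++ [seq (a - k, b - k) | k <- iota 1 (minn a b)]
  ++ (if a <= b then [seq (a - k, b - l) | k <- iota 1 a, l <- iota 0 k]
      else [::])
  ++ (if b <= a then [seq (a - l, b - k) | k <- iota 1 b, l <- iota 0 k]
      else [::]).

Lemma optionsP p q : reflect (move p q) (q \in options p).
Proof.
case: p => a b; apply: (iffP idP).
- rewrite /options !mem_cat => /or4P[||| /orP[]].
  + by case/mapP=> k; rewrite mem_iota => hk ->; apply: Move_fst; lia.
  + by case/mapP=> k; rewrite mem_iota => hk ->; apply: Move_snd; lia.
  + by case/mapP=> k; rewrite mem_iota => hk ->; apply: Move_both; lia.
  + case: ifP => // ab /allpairsPdep[k [l []]].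
    by rewrite !mem_iota => hk hl ->; apply: Move_smaller_fst; lia.
  + case: ifP => // ab /allpairsPdep[k [l []]].
    by rewrite !mem_iota => hk hl ->; apply: Move_smaller_snd; lia.
- move E: (a, b) => p mpq.
  case: mpq E => {p q} a' b' k => [hk|hk|hk|l ab hk hl|l ab hk hl] _;
    rewrite /options !mem_cat.
  + by apply/or4P; apply: Or41; apply: map_f; rewrite mem_iota; lia.
  + by apply/or4P; apply: Or42; apply/mapP; exists k => //; rewrite mem_iota; lia.
  + by apply/or4P; apply: Or43; apply/mapP; exists k => //; rewrite mem_iota; lia.
  + apply/or4P; apply: Or44; apply/orP; left; rewrite ab.
    by apply/allpairsPdep; exists k, l; rewrite !mem_iota; split => //; lia.
  + apply/or4P; apply: Or44; apply/orP; right; rewrite ab.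
    by apply/allpairsPdep; exists k, l; rewrite !mem_iota; split => //; lia.
Qed.

Lemma mex_subproof (s : seq nat) : exists n, n \notin s.
Proof.
exists (sumn s).+1; apply/negP => /perm_to_rem/perm_sumn /=; lia.
Qed.

Definition mex (s : seq nat) : nat := ex_minn (mex_subproof s).

(* [n] bounds the length of the play; it decreases at each move, and          *)
(* [(p.1 + p.2).+1] is enough since every move removes a token ([grundyE]).   *)
Fixpoint grundy_rec (n : nat) (p : position) : nat :=
  if n is n'.+1 then mex [seq grundy_rec n' q | q <- options p] else 0.

Definition grundy (p : position) : nat := grundy_rec (p.1 + p.2).+1 p.

Lemma move_lt p q : move p q -> q.1 + q.2 < p.1 + p.2.
Proof. by case=> * /=; lia. Qed.

Lemma grundy_rec_eq n m p :
  p.1 + p.2 < n -> p.1 + p.2 < m -> grundy_rec n p = grundy_rec m p.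
Proof.
elim: n m p => // n IH [//|m] p hn hm /=; congr mex.
by apply/eq_in_map => q /optionsP/move_lt hq; apply: IH; lia.
Qed.

Lemma grundyE p : grundy p = mex [seq grundy q | q <- options p].
Proof.
rewrite {1}/grundy /=; congr mex; apply/eq_in_map => q /optionsP/move_lt hq.
by apply: grundy_rec_eq; lia.
Qed.

Lemma eq_mex (s t : seq nat) : s =i t -> mex s = mex t.
Proof.
move=> st; rewrite /mex; case: ex_minnP => m hm mmin.
case: ex_minnP => n hn nmin; apply/eqP; rewrite eqn_leq.
by rewrite mmin ?st // nmin // -st.
Qed.

Lemma moveC a b c d : move (a, b) (c, d) -> move (b, a) (d, c).
Proof.
move E: (a, b) => p; move F: (c, d) => q m.
case: m E F => {p q} a' b' k => [hk|hk|hk|l ab hk hl|l ab hk hl] [-> ->] [-> ->].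
- exact: Move_snd.
- exact: Move_fst.
- by apply: Move_both; rewrite minnC.
- exact: Move_smaller_snd.
- exact: Move_smaller_fst.
Qed.

Lemma grundyC a b : grundy (a, b) = grundy (b, a).
Proof.
have [n] := ubnP (a + b); elim: n a b => // n IH a b hn.
rewrite !grundyE; apply: eq_mex => c; apply/mapP/mapP => -[[x y] /optionsP m ->];
  have h := move_lt m; exists (y, x); try exact/optionsP/moveC;
  by apply: IH; move: h => /=; lia.
Qed.

(* Main.v *)
From Stdlib Require Import Classical.
Require Import Defs.
From mathcomp Require Import all_boot zify.

(** Within a row every position is an option of every later one, so a row takes
    each value at most once. If row [a] missed the value [c], then far out in
    this row all values would exceed [c], so each position would have an option
    of value [c], necessarily in one of the rows [a' < a] and, since the first
    pile is the smaller one, at most [a] columns to the left. But these finitely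
    many rows contain finitely many positions of value [c]. *)

Lemma mex_notin (s : seq nat) : mex s \notin s.
Proof. by rewrite /mex; case: ex_minnP. Qed.

Lemma lt_mex_in (s : seq nat) c : c < mex s -> c \in s.
Proof.
rewrite /mex; case: ex_minnP => m _ min_m c_lt_m.
by apply: contraLR c_lt_m => /min_m; rewrite leqNgt.
Qed.

Lemma grundy_neq p q : move p q -> grundy p <> grundy q.
Proof.
move=> /optionsP pq e; have := mex_notin [seq grundy r | r <- options p].
by rewrite -grundyE e map_f.
Qed.

Lemma move_of_lt_grundy p c : c < grundy p -> exists2 q, move p q & grundy q = c.
Proof.
rewrite grundyE => /lt_mex_in/mapP[q /optionsP pq ->].
by exists q.
Qed.

Lemma grundy_row_inj a : injective (fun b => grundy (a, b)).
Proof.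
have neq b b' : b' < b -> grundy (a, b) <> grundy (a, b').
  move=> lt; have -> : b' = b - (b - b') by lia.
  by apply: grundy_neq; apply: Move_snd; lia.
by move=> b b' e; case: (ltngtP b b') => // /neq; rewrite e.
Qed.

Lemma inj_eventually_neq (f : nat -> nat) c :
  injective f -> exists B, forall b, B <= b -> f b <> c.
Proof.
move=> f_inj; case: (classic (exists b, f b = c)) => [[b0 fb0]|no].
  by exists b0.+1 => b hb; rewrite -fb0 => /f_inj; lia.
by exists 0 => b _ fb; apply: no; exists b.
Qed.

(** The largest of the [n] thresholds works. This serves both for the values below [c] in row [a]
    and for the rows before [a]. *)
Lemma eventually_all_lt (P : nat -> nat -> Prop) n :
    (forall i, exists B, forall b, B <= b -> P i b) ->
  exists B, forall i b, i < n -> B <= b -> P i b.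
Proof.
move=> evP; elim: n => [|n [B hB]]; first by exists 0.
have [B' hB'] := evP n; exists (maxn B B') => i b.
rewrite ltnS geq_max leq_eqVlt => /predU1P[->|lt_in] /andP[hb hb'].
  exact: hB'.
exact: hB.
Qed.

(** A move that takes [k] tokens from the smaller first pile takes at most [k], hence at most [a],
    from the second. *)
Lemma move_long_row a b q :
  a < b -> move (a, b) q -> q.1 = a \/ q.1 < a /\ b - a <= q.2.
Proof.
move=> lt_ab; move E: (a, b) => p m.
by case: m E => {p q} a' b' k => [hk|hk|hk|l ab hk hl|l ab hk hl] [ea eb] /=; lia.
Qed.

Theorem theorem3p3 (a c : nat) : exists! b : nat, grundy (a, b) = c.
Proof.
suff [b gb] : exists b, grundy (a, b) = c.
  by exists b; split=> // b' gb'; apply: (grundy_row_inj a); rewrite gb gb'.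
apply: NNPP => missed.
have [B hB] : exists B, forall v b, v < c -> B <= b -> grundy (a, b) <> v.
  by apply: eventually_all_lt => v; apply: inj_eventually_neq (grundy_row_inj a).
have [B' hB'] : exists B', forall i b, i < a -> B' <= b -> grundy (i, b) <> c.
  by apply: eventually_all_lt => i; apply: inj_eventually_neq (grundy_row_inj i).
(* Large enough to exceed [a] and [B], and to stay beyond [B'] after going [a] columns to the
   left. *)
pose b := (a + B + B').+1.
have lt_c : c < grundy (a, b).
  case: (ltngtP c (grundy (a, b))) => // [lt_gc|e].
    by case: (hB _ b lt_gc _ erefl); rewrite /b; lia.
  by case: missed; exists b.
have [[x y] m gxy] := move_of_lt_grundy _ _ lt_c.
have lt_ab : a < b by rewrite /b; lia.
have [/= xa|/= [lt_xa le_by]] := move_long_row _ _ _ lt_ab m.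
  by apply: missed; exists y; rewrite -xa.
by apply: (hB' x y) => //; move: le_by; rewrite /b; lia.
Qed.
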